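(* Let $(X,d)$ be a Lorentzian metric space without chronological boundary. Then the map $\iota:X\to C(X)\times C(X)$, $\iota(x)=(d_x,d^x)$, is a homeomorphism onto its image. If, in addition, $X$ is countably generated and $\{p^k\}_{k\in\mathbb{N}}$ is a generating sequence for $X$, then the function $\gamma:X\times X\to[0,+\infty)$ defined by $$\gamma(x,y):=\sum_{m=1}^{\infty}2^{-m}\frac{\|d_x-d_y\|_{X^m}}{1+\|d_x-d_y\|_{X^m}}+\sum_{m=1}^{\infty}2^{-m}\frac{\|d^x-d^y\|_{X^m}}{1+\|d^x-d^y\|_{X^m}}$$ is a metric on $X$ inducing the Lorentzian metric space topology of $X$.
   Context: Let $X$ be a set and $d:X\times X\to[0,+\infty)$ a function. Notation: $d_x(y)=d^y(x)=d(x,y)$; $x\ll y$ iff $d(x,y)>0$; $I^+(x)=\{y: x\ll y\}$, $I^-(x)=\{y: y\ll x\}$; for $A\subset X$, $I^\pm(A)=\bigcup_{p\in A}I^\pm(p)$ and $I(A)=I^+(A)\cap I^-(A)$; $I(p^1,\dots,p^m):=I(\{p^1,\dots,p^m\})$. For $\epsilon>0$, $I_\epsilon=\{(x,y): d(x,y)\ge\epsilon\}$. $(X,d)$ is a Lorentzian metric space if: (i) $d(x,z)\ge d(x,y)+d(y,z)$ whenever $d(x,y)>0$ and $d(y,z)>0$; (ii) there is a topology $T$ on $X$ such that $d$ is continuous in the product topology and, for every $x,y\in X$ and $\epsilon>0$, the set $I_\epsilon\cap(\overline{I(x,y)}\times\overline{I(x,y)})$ is compact; (iii) for all $x\ne y$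 there is $z\in X$ with $d(x,z)\ne d(y,z)$ or $d(z,x)\ne d(z,y)$. It has no chronological boundary if there is no $x$ with $d(x,\cdot)\equiv0$ and no $x$ with $d(\cdot,x)\equiv0$; then the topology in (ii) is unique (Hausdorff, locally compact), it is called the Lorentzian metric space topology, and $X$ is endowed with it. A generating sequence is a sequence $\{p^k\}_{k\in\mathbb{N}}$ in $X$ with $I(\{p^k:k\in\mathbb{N}\})=X$; $X$ is countably generated if it has a countable generating set. $C(X)$ is the space of continuous real functions on $X$ with the topology of uniform convergence on compact subsets, generated by the seminorms $\|f\|_K=\sup_{x\in K}|f(x)|$, $K\subset X$ compact. $X^m:=\overline{I(p^1,\dots,p^m)}\cup\{p^1,\dots,p^m\}$ (a compact set). *)

(* Defs.v *)
From HB Require Import structures.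
From mathcomp Require Import all_boot all_order all_algebra.
From mathcomp Require Import all_classical all_reals all_analysis.
Set Implicit Arguments.
Unset Strict Implicit.
Unset Printing Implicit Defensive.
Import Order.TTheory GRing.Theory Num.Theory.
Import numFieldNormedType.Exports.
Local Open Scope classical_set_scope.
Local Open Scope ring_scope.

Section Chronology.
Context {R : realType} {X : Type} (d : X -> X -> R).

Definition chron (x y : X) : Prop := 0 < d x y.

Definition Iplus (A : set X) : set X := \bigcup_(p in A) [set y | chron p y].
Definition Iminus (A : set X) : set X := \bigcup_(p in A) [set y | chron y p].
Definition Idiam (A : set X) : set X := Iplus A `&` Iminus A.

Definition Ige (eps : R) : set (X * X) := [set z | eps <= d z.1 z.2].

Definition no_chronological_boundary : Prop :=
  ~ (exists x, forall y, d x y = 0) /\ ~ (exists x, forall y, d y x = 0).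

Definition generating_set (A : set X) : Prop := Idiam A = [set: X].
Definition generating_sequence (p : nat -> X) : Prop := generating_set (range p).
Definition countably_generated : Prop :=
  exists A : set X, countable A /\ generating_set A.

End Chronology.

(* The topology of X is the one required to exist in the definition of a
   Lorentzian metric space; without chronological boundary it is unique. *)
Record lorentzian_metric_space (R : realType) (X : topologicalType)
    (d : X -> X -> R) : Prop := LorentzianMetricSpace {
  lms_ge0 : forall x y, 0 <= d x y ;
  lms_reverse_triangle : forall x y z,
    0 < d x y -> 0 < d y z -> d x y + d y z <= d x z ;
  lms_continuous : continuous (fun z : X * X => d z.1 z.2) ;
  lms_compact : forall (x y : X) (eps : R), 0 < eps ->
    compact (Ige d eps `&`
      (closure (Idiam d [set x; y]) `*` closure (Idiam d [set x; y]))) ;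
  lms_distinguishes : forall x y, x <> y ->
    exists z, d x z <> d y z \/ d z x <> d z y
}.

(* C(X): the topology is induced by the inclusion into the space of all
   functions with uniform convergence on compact sets. *)
Definition continuous_functions (X : topologicalType) (R : realType) :
    topologicalType :=
  initial_topology (id : continuousType X R -> {family compact, X -> R}).

Section Iota.
Context {R : realType} {X : topologicalType} (d : X -> X -> R).
Context (lms : lorentzian_metric_space d).

Lemma lms_continuousl (x : X) : continuous (fun y => d x y).
Proof.
move=> y; apply: (@continuous_comp _ _ _ (fun y => (x, y))
  (fun z : X * X => d z.1 z.2)); last exact: lms_continuous.
by apply: cvg_pair; [exact: cvg_cst | exact: cvg_id].
Qed.

Lemma lms_continuousr (x : X) : continuous (fun y => d y x).
Proof.
move=> y; apply: (@continuous_comp _ _ _ (fun y => (y, x))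
  (fun z : X * X => d z.1 z.2)); last exact: lms_continuous.
by apply: cvg_pair; [exact: cvg_id | exact: cvg_cst].
Qed.

Definition iota_map (x : X) :
    continuous_functions X R * continuous_functions X R :=
  (mkcts (@lms_continuousl x) : continuousType X R,
   mkcts (@lms_continuousr x) : continuousType X R).

End Iota.

Definition homeomorphism (X Y : topologicalType) (f : X -> Y) : Prop :=
  exists g : Y -> X, [/\ cancel f g, cancel g f, continuous f & continuous g].

Definition to_range (X Y : Type) (f : X -> Y) (x : X) : range f :=
  exist _ (f x) (mem_set (imageT f x)).

Definition homeomorphism_onto_image (X Y : topologicalType) (f : X -> Y) : Prop :=
  homeomorphism (to_range f).

Definition seminorm_on (R : realType) (X : Type) (K : set X) (f : X -> R) : R :=
  sup [set `|f x| | x in K].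

Section Gamma.
Context {R : realType} {X : topologicalType} (d : X -> X -> R) (p : nat -> X).

(* [p k] is the term p^(k+1), so the image of [`I_m] is {p^1, ..., p^m}. *)
Definition Xm (m : nat) : set X :=
  closure (Idiam d (p @` `I_m)) `|` (p @` `I_m).

Definition bounded_norm (m : nat) (f : X -> R) : R :=
  seminorm_on (Xm m) f / (1 + seminorm_on (Xm m) f).

Definition gamma_metric (x y : X) : R :=
  limn (fun n => \sum_(1 <= m < n)
    2 ^- m * bounded_norm m (fun z => d x z - d y z)) +
  limn (fun n => \sum_(1 <= m < n)
    2 ^- m * bounded_norm m (fun z => d z x - d z y)).

End Gamma.

Definition is_metric (R : realType) (X : Type) (g : X -> X -> R) : Prop :=
  [/\ forall x y, 0 <= g x y,
      forall x y, g x y = 0 <-> x = y,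
      forall x y, g x y = g y x
    & forall x y z, g x z <= g x y + g y z].

Definition induces_topology (R : realType) (X : topologicalType)
    (g : X -> X -> R) : Prop :=
  forall U : set X, open U <->
    forall x, U x -> exists2 r : R, 0 < r & [set y | g x y < r] `<=` U.

(* Main.v *)
Require Import Defs.
From HB Require Import structures.
From mathcomp Require Import all_boot all_order all_algebra.
From mathcomp Require Import all_classical all_reals all_analysis.
From mathcomp Require Import lra.
Import Order.TTheory GRing.Theory Num.Theory.
Import numFieldNormedType.Exports.
Local Open Scope classical_set_scope.
Local Open Scope ring_scope.

(* Every point lies in some I(a, b), and axiom (ii) makes I(a, b) relatively
   compact.  Hence a filter along which all d(z, .) and d(., z) converge to their
   values at x eventually lies in a compact set, where its only cluster point is x
   because these functions separate points; so it converges to x.  The topology of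
   X is thus already the one of pointwise convergence of (d_x, d^x), while joint
   continuity of d makes x |-> (d_x, d^x) continuous for uniform convergence on
   compact sets.  Both iota and gamma lie between these two modes of convergence,
   the sets X^m being compact and covering X. *)

(** * Series with dyadic weights [2 ^- m] *)

Section WeightedSeries.
Context {R : realType}.
Implicit Types (a b c : nat -> R) (n m : nat).

Definition dyadic_sum a n : R := \sum_(1 <= m < n) 2 ^- m * a m.

Lemma dyadic_sum_le a b n : (forall m, a m <= b m) ->
  dyadic_sum a n <= dyadic_sum b n.
Proof.
by move=> ab; apply: ler_sum => m _; rewrite ler_wpM2l// invr_ge0 exprn_ge0.
Qed.

Lemma dyadic_sumD a b n :
  dyadic_sum (fun m => a m + b m) n = dyadic_sum a n + dyadic_sum b n.
Proof. by rewrite -big_split; apply: eq_bigr => m _; rewrite mulrDr. Qed.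

Lemma dyadic_sumZ r a n :
  dyadic_sum (fun m => r * a m) n = r * dyadic_sum a n.
Proof. by rewrite mulr_sumr; apply: eq_bigr => m _; rewrite mulrCA. Qed.

Lemma dyadic_sum_tail M n :
  dyadic_sum (fun m => (M < m)%:R) n <= 2 ^- M.
Proof.
(* Adding the remainder [2 ^- maxn n M] makes the bound inductive: past [M], each new term is
   exactly what the remainder loses by halving. *)
suff: dyadic_sum (fun m => (M < m)%:R) n.+1 + 2 ^- maxn n M <= 2 ^- M.
  rewrite /dyadic_sum; case: n => [|n].
    by move=> _; rewrite big_geq// invr_ge0 exprn_ge0.
  rewrite big_nat_recr//= => h; apply: le_trans h.
  by rewrite -addrA lerDl addr_ge0 ?mulr_ge0 ?invr_ge0 ?exprn_ge0.
elim: n => [|n IHn]; first by rewrite /dyadic_sum big_geq// add0r max0n.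
rewrite /dyadic_sum big_nat_recr//= -/(dyadic_sum _ _) ltnS.
have [Mn|nM] := leqP M n.
  rewrite mulr1; move: IHn; rewrite (maxn_idPl Mn) (maxn_idPl (leqW Mn)).
  rewrite exprSr invfM; set t := 2 ^- n; set s := dyadic_sum _ _; lra.
by rewrite mulr0 addr0 (maxn_idPr nM); move: IHn; rewrite (maxn_idPr (ltnW nM)).
Qed.

Lemma is_cvg_dyadic_sum a : (forall m, 0 <= a m <= 1) -> cvgn (dyadic_sum a).
Proof.
move=> a01; apply: nondecreasing_is_cvgn.
  apply/nondecreasing_seqP => n; rewrite /dyadic_sum; case: n => [|n].
    by rewrite !big_geq.
  rewrite [leRHS]big_nat_recr//= lerDl mulr_ge0 ?invr_ge0 ?exprn_ge0//.
  by case/andP: (a01 n.+1).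
exists 1 => _ [n _ <-]; apply: (@le_trans _ _ (dyadic_sum (fun m => (0 < m)%:R) n)).
  rewrite /dyadic_sum big_nat [leRHS]big_nat; apply: ler_sum => m /andP[m0 _].
  by rewrite m0 ler_wpM2l ?invr_ge0 ?exprn_ge0//; case/andP: (a01 m).
by rewrite (le_trans (dyadic_sum_tail _ _))// expr0 invr1.
Qed.

Lemma lim_dyadic_sum_ge a m : (forall m, 0 <= a m <= 1) -> (0 < m)%N ->
  2 ^- m * a m <= limn (dyadic_sum a).
Proof.
move=> a01 m0; have a0 k : 0 <= 2 ^- k * a k.
  by rewrite mulr_ge0 ?invr_ge0 ?exprn_ge0//; case/andP: (a01 k).
apply: limr_ge; first exact: is_cvg_dyadic_sum.
near=> n; rewrite /dyadic_sum (@big_cat_nat _ _ _ m.+1)//=; last by near: n; exists m.+1.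
rewrite big_nat_recr//= [X in X + _]addrC -addrA lerDl.
by rewrite addr_ge0// sumr_ge0.
Unshelve. all: by end_near. Qed.

Lemma lim_dyadic_sum_ge0 a : (forall m, 0 <= a m <= 1) ->
  0 <= limn (dyadic_sum a).
Proof.
move=> a01; apply: le_trans (@lim_dyadic_sum_ge _ 1 a01 _) => //.
by rewrite mulr_ge0 ?invr_ge0 ?exprn_ge0//; case/andP: (a01 1%N).
Qed.

Lemma lim_dyadic_sum_leD a b c :
  (forall m, 0 <= a m <= 1) -> (forall m, 0 <= b m <= 1) ->
  (forall m, 0 <= c m <= 1) -> (forall m, a m <= b m + c m) ->
  limn (dyadic_sum a) <= limn (dyadic_sum b) + limn (dyadic_sum c).
Proof.
move=> /is_cvg_dyadic_sum ca /is_cvg_dyadic_sum cb /is_cvg_dyadic_sum cc abc.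
rewrite -limD//; apply: ler_lim => //; first exact: is_cvgD.
by apply: nearW => n /=; rewrite fctE -dyadic_sumD dyadic_sum_le.
Qed.

(** [a m] is dominated by [e] up to [M] and by [e + 1] beyond; all weights together sum to at most
    1, those beyond [M] to at most [2 ^- M]. *)
Lemma lim_dyadic_sum_le a e M : 0 <= e -> (forall m, 0 <= a m <= 1) ->
  (forall m, (m <= M)%N -> a m <= e) -> limn (dyadic_sum a) <= e + 2 ^- M.
Proof.
move=> e0 a01 ae; apply: limr_le; first exact: is_cvg_dyadic_sum.
apply: nearW => n.
apply: (@le_trans _ _ (dyadic_sum (fun m => e * (0 < m)%:R + (M < m)%:R) n)).
  rewrite /dyadic_sum big_nat [leRHS]big_nat; apply: ler_sum => m /andP[m0 _].
  rewrite m0 mulr1 ler_wpM2l ?invr_ge0 ?exprn_ge0//.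
  case: ltnP => [Mm|mM]; last by rewrite addr0 ae.
  by case/andP: (a01 m) => _ /le_trans; apply; rewrite lerDr.
rewrite dyadic_sumD lerD ?dyadic_sum_tail// dyadic_sumZ ler_piMr//.
by rewrite (le_trans (dyadic_sum_tail _ _))// expr0 invr1.
Qed.

End WeightedSeries.

Lemma exists_dyadic_lt {R : realType} (e : R) : 0 < e ->
  exists M, 2 ^- M < e.
Proof.
move=> e0; have [M _ /(_ M (leqnn M))] := near_infty_natSinv_expn_lt (PosNum e0).
by rewrite /= div1r => Me; exists M.
Qed.

(** * The transform s / (1 + s) and sup-seminorms *)

Section Bounded.
Context {R : realType}.
Implicit Types r s t : R.

Lemma ler_div1D {s t} : 0 <= s -> s <= t -> s / (1 + s) <= t / (1 + t).
Proof.
move=> s0 st; have t0 : 0 <= t by lra.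
rewrite ler_pdivrMr ?ltr_wpDr// mulrAC ler_pdivlMr ?ltr_wpDr//; nra.
Qed.

Lemma div1D_ge0_le1 {s} : 0 <= s -> 0 <= s / (1 + s) <= 1.
Proof.
move=> s0; rewrite divr_ge0 ?addr_ge0//= ler_pdivrMr ?ltr_wpDr//; lra.
Qed.

Lemma div1D_le {s} : 0 <= s -> s / (1 + s) <= s.
Proof. by move=> s0; rewrite ler_pdivrMr ?ltr_wpDr//; nra. Qed.

(** Monotonicity replaces [r] by [s + t]; after splitting the fraction, shrinking the denominators
    to [1 + s] and [1 + t] only increases it. *)
Lemma div1D_leD {r s t} : 0 <= r -> 0 <= s -> 0 <= t -> r <= s + t ->
  r / (1 + r) <= s / (1 + s) + t / (1 + t).
Proof.
move=> r0 s0 t0 rst; apply: (le_trans (ler_div1D r0 rst)).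
by rewrite mulrDl lerD// ler_wpM2l// lef_pV2 ?posrE; lra.
Qed.

End Bounded.

Section Seminorm.
Context {R : realType} {X : topologicalType}.
Implicit Types (K : set X) (f g : X -> R).

Lemma seminorm_on_ge0 K f : 0 <= seminorm_on K f.
Proof.
rewrite /seminorm_on.
(* If [K] is empty or [f] is unbounded on [K], then [sup] takes its default value 0. *)
have [|/sup_out->//] := pselect (has_sup [set `|f x| | x in K]).
case=> [[_ [z Kz _]] ub]; apply: (le_trans (normr_ge0 (f z))).
by apply: ub_le_sup => //; exists z.
Qed.

Lemma seminorm_on_ge {K f z} : compact K -> continuous f -> K z ->
  `|f z| <= seminorm_on K f.
Proof.
move=> cK cf Kz; apply: ub_le_sup; last by exists z.
have := compact_bounded (continuous_compact (continuous_subspaceT cf) cK).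
case=> M [_ /(_ (M + 1))]; rewrite ltrDl ltr01 => /(_ isT) h.
by exists (M + 1) => _ [y Ky <-]; apply: h; exists y.
Qed.

Lemma seminorm_on_le {K f e} : 0 <= e -> (forall z, K z -> `|f z| <= e) ->
  seminorm_on K f <= e.
Proof.
move=> e0 fe; rewrite /seminorm_on.
have [->|/set0P K0] := eqVneq K set0; first by rewrite image_set0 sup0.
apply: ge_sup; first by case: K0 => z Kz; exists `|f z|, z.
by move=> _ [z Kz <-]; exact: fe.
Qed.

End Seminorm.

(** * Pseudometrics from seminorms on a sequence of compact sets *)

Section CompactSeries.
Context {R : realType} {X : topologicalType} (K : nat -> set X)
  (F : X -> X -> R).
Hypotheses (cK : forall m, compact (K m)) (cF : forall x, continuous (F x)).

Let norm m x y := seminorm_on (K m) (fun z => F x z - F y z).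

Let frac m x y := norm m x y / (1 + norm m x y).

(** Both halves of [gamma_metric] are instances, with [F] equal to [d] or to [d] with its arguments
    swapped. *)
Definition compact_series x y : R := limn (dyadic_sum (frac ^~ x ^~ y)).

Let cFB x y : continuous (fun z => F x z - F y z).
Proof. by move=> z; apply: cvgB; exact: cF. Qed.

Let norm_ge0 m x y : 0 <= norm m x y. Proof. exact: seminorm_on_ge0. Qed.

Let frac01 x y m : 0 <= frac m x y <= 1.
Proof. exact/div1D_ge0_le1/norm_ge0. Qed.

Lemma compact_series_ge0 x y : 0 <= compact_series x y.
Proof. exact/lim_dyadic_sum_ge0/frac01. Qed.

Lemma compact_seriesC x y : compact_series x y = compact_series y x.
Proof.
congr (limn (dyadic_sum _)); apply/funext => m.
suff xyC : norm m x y = norm m y x by rewrite /= /frac xyC.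
congr (sup _); apply: eq_imagel => z _; exact: distrC.
Qed.

Lemma compact_series_triangle x y z :
  compact_series x z <= compact_series x y + compact_series y z.
Proof.
apply: lim_dyadic_sum_leD => m; try exact: frac01.
apply: div1D_leD => //; apply: seminorm_on_le; first exact: addr_ge0.
move=> t Kt; rewrite -(subrKA (F y t)) (le_trans (ler_normD _ _))// lerD//.
  exact: (seminorm_on_ge (cK m) (cFB x y) Kt).
exact: (seminorm_on_ge (cK m) (cFB y z) Kt).
Qed.

Lemma compact_seriesxx x : compact_series x x = 0.
Proof.
apply/eqP; rewrite eq_le compact_series_ge0 andbT.
apply/ler_addgt0Pr => e e0; rewrite add0r.
have [M Me] : exists M, (2 ^- M : R) < e by exact: exists_dyadic_lt.
rewrite (le_trans _ (ltW Me))// -[leRHS]add0r.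
apply: lim_dyadic_sum_le => // m _; rewrite /frac.
suff -> : norm m x x = 0 by rewrite mul0r.
apply/eqP; rewrite eq_le norm_ge0 andbT; apply: seminorm_on_le => // z _.
by rewrite subrr normr0.
Qed.

Lemma compact_series_control m z x e : (0 < m)%N -> K m z -> 0 < e ->
  exists2 r, 0 < r & forall y, compact_series x y < r -> `|F x z - F y z| < e.
Proof.
(* If the seminorm on [K m] reached [e], the term of index [m] alone would be at least this radius.
   Positivity of [m] matters because the series starts at index 1. *)
move=> m0 Kz e0; exists (2 ^- m * (e / (1 + e))).
  by rewrite mulr_gt0 ?divr_gt0 ?invr_gt0 ?exprn_gt0 ?addr_gt0.
move=> y xy; apply: (le_lt_trans (seminorm_on_ge (cK m) (cFB x y) Kz)).
rewrite ltNge; apply/negP => /(ler_div1D (ltW e0)) ef.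
have := lt_le_trans xy (ler_wpM2l _ ef); rewrite invr_ge0 exprn_ge0// => /(_ isT).
by rewrite ltNge lim_dyadic_sum_ge//; exact: frac01.
Qed.

(** Only finitely many seminorms have to be made small: the terms beyond a suitable [M] contribute
    less than [e / 2]. *)
Lemma compact_series_near x e : 0 < e ->
  (forall m r, 0 < r -> \forall y \near x, forall z, K m z -> `|F x z - F y z| < r) ->
  \forall y \near x, compact_series x y < e.
Proof.
move=> e0 unif; have e20 : 0 < e / 2 by rewrite divr_gt0.
have [M Me] : exists M, (2 ^- M : R) < e / 2 by exact: exists_dyadic_lt.
(* Induction on [M] intersects the finitely many neighbourhoods. *)
have : \forall y \near x, forall m, (m <= M)%N -> norm m x y <= e / 2.
  elim: M {Me} => [|M IHM].
    have := unif 0%N _ e20; apply: filterS => y h m; rewrite leqn0 => /eqP ->.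
    by apply: seminorm_on_le (ltW e20) _ => z Kz; exact/ltW/h.
  have := unif M.+1 _ e20; apply: filterS2 IHM => y IH h m.
  rewrite leq_eqVlt => /predU1P[->|]; last by rewrite ltnS; exact: IH.
  by apply: seminorm_on_le (ltW e20) _ => z Kz; exact/ltW/h.
apply: filterS => y h; rewrite [ltRHS]splitr.
apply: le_lt_trans (_ : _ <= e / 2 + 2 ^- M) _; last by rewrite ltrD2l.
apply: lim_dyadic_sum_le; [exact: ltW|exact: frac01|].
by move=> m /h; apply: le_trans; exact/div1D_le/norm_ge0.
Qed.

End CompactSeries.

(** * Cluster points, and uniform convergence on compact sets *)

Lemma cluster_cvg_eq {X Y : topologicalType} {F : set_system X} (f : X -> Y) {c l} :
  hausdorff_space Y -> continuous f -> cluster F c -> f @ F --> l -> f c = l.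
Proof.
move=> hY cf Fc Fl; apply/esym/hY => A B lA cB.
by have [z [Az Bz]] := Fc _ _ (Fl _ lA) (cf c _ cB); exists (f z).
Qed.

(** Currying a jointly continuous map is continuous for the compact-open topology, in which
    convergence to a continuous function is uniform convergence on compact sets. *)
Lemma curry_cvg_compact {U V : topologicalType} {W : puniformType}
    (f : U * V -> W) (x : U) :
  continuous f -> {family compact, curry f @ x --> curry f x}.
Proof.
move=> cf; have [c1 c2] := continuous_curry cf.
by apply/compact_open_fam_compactP => //; exact: c1.
Qed.

Lemma curry_near_compact {R : realType} {U V : topologicalType}
    (f : U * V -> R) (x : U) (K : set V) e : continuous f -> compact K -> 0 < e ->
  \forall y \near x, forall z, K z -> `|f (x, z) - f (y, z)| < e.
Proof.
move=> cf cK e0; have /fam_cvgP/(_ K cK) unif := curry_cvg_compact f x cf.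
apply: (unif [set g | forall z, K z -> ball (f (x, z)) e (g z)]).
apply/uniform_nbhs; exists [set xy | ball xy.1 e xy.2]; split => //.
exact: entourage_ball (PosNum e0).
Qed.

(** * Chronology and topology of a Lorentzian metric space *)

Section Lorentzian.
Context {R : realType} {X : topologicalType} (d : X -> X -> R)
  (lms : lorentzian_metric_space d).

Lemma chron_trans {x y z} : chron d x y -> chron d y z -> chron d x z.
Proof.
move=> xy yz; apply: lt_le_trans (lms_reverse_triangle lms xy yz).
exact: addr_gt0.
Qed.

Lemma lms_separates {x y} : (forall z, d x z = d y z) ->
  (forall z, d z x = d z y) -> x = y.
Proof.
move=> h1 h2; apply: contrapT => /(lms_distinguishes lms)[z [|]] //.
Qed.

Lemma lms_continuous_swap : continuous (fun z : X * X => d z.2 z.1).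
Proof.
move=> z; apply: (@continuous_comp _ _ _ (fun z : X * X => (z.2, z.1))
  (fun z : X * X => d z.1 z.2)); last exact: lms_continuous.
by apply: cvg_pair; [exact: cvg_snd|exact: cvg_fst].
Qed.

Hypothesis ncb : no_chronological_boundary d.

Lemma chron_past x : exists y, chron d y x.
Proof.
apply: contrapT => nx; apply: ncb.2; exists x => y; apply/eqP.
rewrite -[_ == _]negbK; apply/negP => yx0; apply: nx; exists y.
by rewrite /chron lt_def yx0 lms_ge0.
Qed.

Lemma chron_future x : exists y, chron d x y.
Proof.
apply: contrapT => nx; apply: ncb.1; exists x => y; apply/eqP.
rewrite -[_ == _]negbK; apply/negP => yx0; apply: nx; exists y.
by rewrite /chron lt_def yx0 lms_ge0.
Qed.

(* With q' << q << p and e = d(q, p), every point z between p and r satisfies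
   d(q, z) >= e, and both q and z lie in I(q', r); so z is the second coordinate of
   a point of the compact set of axiom (ii) attached to q', r and e. *)
Lemma chron_interval_compact p r :
  exists2 C : set X, compact C & forall z, chron d p z -> chron d z r -> C z.
Proof.
have [q qp] := chron_past p; have [q' q'q] := chron_past q.
pose D := closure (Idiam d [set q'; r]).
exists (snd @` (Ige d (d q p) `&` (D `*` D))).
  apply: continuous_compact; last exact: lms_compact.
  by apply: continuous_subspaceT => z; exact: cvg_snd.
move=> z pz zr; exists (q, z) => //; split => /=.
  rewrite /Ige /=; apply: le_trans (lms_reverse_triangle lms qp pz).
  by rewrite lerDl ltW.
have ID t : chron d q' t -> chron d t r -> D t.
  by move=> ? ?; apply: subset_closure; split; [exists q'|exists r] => //=; auto.
have qz := chron_trans qp pz.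
by split => /=; apply: ID => //; [exact: chron_trans zr|exact: chron_trans qz].
Qed.

Lemma cluster_lms_unique {F : set_system X} {c x} : cluster F c ->
  (forall z, d z @ F --> d z x) -> (forall z, d ^~ z @ F --> d x z) -> c = x.
Proof.
move=> Fc Fl Fr; apply: lms_separates => z.
  exact: (cluster_cvg_eq (d ^~ z) (@Rhausdorff R) (lms_continuousr lms (x := z)) Fc).
exact: (cluster_cvg_eq (d z) (@Rhausdorff R) (lms_continuousl lms (x := z)) Fc).
Qed.

(** If [y] is a cluster point of the neighbourhood filter of [x], continuity of [d] gives [y] and
    [x] the same distances to and from every point. *)
Lemma lms_hausdorff : hausdorff_space X.
Proof.
move=> x y xy; apply/esym/(cluster_lms_unique xy) => z.
  exact: (lms_continuousl lms).
exact: (lms_continuousr lms).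
Qed.

Lemma lms_cvg (F : set_system X) x : Filter F ->
  (forall z, d z @ F --> d z x) -> (forall z, d ^~ z @ F --> d x z) -> F --> x.
Proof.
move=> FF Fl Fr U; rewrite nbhsE => -[V [oV Vx] VU]; apply: (filterS VU).
apply: contrapT => nFV.
(* If [V] were not in [F], the trace of [F] on the complement of [V] would be proper, and
   compactness would give it a cluster point. *)
have PG : ProperFilter (within (~` V) F).
  split; last exact: within_filter.
  move=> G0; apply: nFV; apply: (@filterS _ _ _ [set y | (~` V) y -> set0 y] _ _ G0).
  by move=> y nVy; exact: contrapT.
have [a ax] := chron_past x; have [b xb] := chron_future x.
have [C cC abC] := chron_interval_compact a b.
(* The conditions a << y and y << b hold eventually along [F], since d(a, .) and d(., b) converge to
   positive limits. *)
have GC : within (~` V) F C.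
  have Fa : F [set y | chron d a y] := Fl a _ (lt_nbhsr ax).
  have Fb : F [set y | chron d y b] := Fr b _ (lt_nbhsr xb).
  by apply: (cvg_within (F := F)); apply: filterS2 Fa Fb; exact: abC.
have [c [_ Gc]] := cC _ PG GC.
(* The complement of [V] is closed, so it retains the cluster point [c]; yet [c] must equal [x],
   which lies in [V]. *)
have : (~` V) c.
  rewrite (closure_id (~` V)).1; last exact: open_closedC.
  by move=> B; apply: Gc; exact: withinT.
have cFx : cluster F c by move=> A B FA; apply: Gc; exact: (cvg_within (F := F)).
by rewrite (cluster_lms_unique cFx Fl Fr).
Qed.

(** I(A) is covered by finitely many compact sets, one for each pair of points of [A]; their union
    is closed because the space is Hausdorff, so it contains the closure. *)
Lemma compact_closure_Idiam (A : set X) : finite_set A ->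
  compact (closure (Idiam d A)).
Proof.
move=> /finite_seqP[s ->].
have /choice[C HC] : forall pq : X * X, exists C : set X, compact C /\
    forall z, chron d pq.1 z -> chron d z pq.2 -> C z.
  by move=> pq; have [C] := chron_interval_compact pq.1 pq.2; exists C.
pose D := \big[setU/set0]_(a <- s) \big[setU/set0]_(b <- s) C (a, b).
have cD : compact D.
  by do 2!(apply: bigsetU_compact => ? _); exact: (HC _).1.
apply: (subclosed_compact _ cD); first exact: closed_closure.
rewrite [X in _ `<=` X](closure_id _).1; last exact: compact_closed lms_hausdorff cD.
apply: closureS => z [[a sa az] [b sb zb]].
rewrite /D -bigcup_seq; exists a => //=; rewrite -bigcup_seq; exists b => //=.
exact: (HC (a, b)).2.
Qed.

Lemma Xm_compact (p : nat -> X) m : compact (Xm d p m).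
Proof.
have fA : finite_set (p @` `I_m) by exact/finite_image/finite_II.
by apply: compactU; [exact: compact_closure_Idiam|exact: finite_compact].
Qed.

Lemma Xm_cover (p : nat -> X) : generating_sequence d p ->
  forall z, exists2 m, (0 < m)%N & Xm d p m z.
Proof.
move=> gen z; have : Idiam d (range p) z by rewrite gen.
move=> [[_ [i _ <-] iz] [_ [j _ <-] zj]].
(* The set [I_m] consists of the indices below [m], so the successor is what includes both [i] and
   [j]. *)
exists (maxn i j).+1 => //; left; apply: subset_closure; split.
  by exists (p i) => //; exists i => //=; rewrite ltnS leq_maxl.
by exists (p j) => //; exists j => //=; rewrite ltnS leq_maxr.
Qed.

End Lorentzian.

(** * The map iota *)

Lemma continuous_functions_eval {R : realType} {X : topologicalType} (z : X) :
  continuous (fun f : continuous_functions X R => (f : continuousType X R) z).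
Proof.
move=> f; have id_cts := @initial_continuous _ {family compact, X -> R}
  (id : continuousType X R -> {family compact, X -> R}).
have fz : {ptws, (id : continuousType X R -> (X -> R)) @ nbhs f -->
    ((f : continuousType X R) : X -> R)}.
  by apply: pointwise_cvg_compact_family; have := id_cts f; exact.
by move/pointwise_cvgP : fz => /(_ z); exact.
Qed.

Lemma iota_map_continuous {R : realType} {X : topologicalType} (d : X -> X -> R)
  (lms : lorentzian_metric_space d) : continuous (iota_map lms).
Proof.
have c1 : continuous (fun x => (iota_map lms x).1).
  apply: continuous_comp_initial => x.
  exact: curry_cvg_compact _ x (lms_continuous lms).
have c2 : continuous (fun x => (iota_map lms x).2).
  apply: continuous_comp_initial => x.
  exact: curry_cvg_compact _ x (lms_continuous_swap d lms).
by move=> x; exact: (cvg_pair (c1 x) (c2 x)).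
Qed.

Lemma iota_map_homeomorphism {R : realType} {X : topologicalType} (d : X -> X -> R)
    (lms : lorentzian_metric_space d) : no_chronological_boundary d ->
  homeomorphism_onto_image (iota_map lms).
Proof.
(* The inverse chooses a preimage; axiom (iii) makes the preimage unique. *)
move=> ncb; pose g (u : range (iota_map lms)) : X := s2val (cid2 (set_mem (valP u))).
have gK u : iota_map lms (g u) = val u by rewrite /g; case: cid2.
have d1 u z : d (g u) z = ((val u).1 : continuousType X R) z by rewrite -gK.
have d2 u z : d z (g u) = ((val u).2 : continuousType X R) z by rewrite -gK.
exists g; split.
- by move=> x; apply: (lms_separates d lms) => z; rewrite ?d1 ?d2.
- by move=> u; apply: val_inj; rewrite /= gK.
- by apply: continuous_comp_initial; exact: iota_map_continuous.
have cval : continuous (set_val : range (iota_map lms) -> _).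
  exact: initial_continuous.
have c1 z : continuous (fun u => d (g u) z).
  rewrite (_ : (fun u => _) = fun u => ((set_val u).1 : continuousType X R) z);
    last by apply/funext => u; exact: d1.
  move=> u; apply: (@continuous_comp _ _ _
    (fun u : range (iota_map lms) => (set_val u).1)
    (fun f : continuous_functions X R => (f : continuousType X R) z)).
    by apply: continuous_comp; [exact: cval|exact: cvg_fst].
  exact: continuous_functions_eval.
have c2 z : continuous (fun u => d z (g u)).
  rewrite (_ : (fun u => _) = fun u => ((set_val u).2 : continuousType X R) z);
    last by apply/funext => u; exact: d2.
  move=> u; apply: (@continuous_comp _ _ _
    (fun u : range (iota_map lms) => (set_val u).2)
    (fun f : continuous_functions X R => (f : continuousType X R) z)).
    by apply: continuous_comp; [exact: cval|exact: cvg_snd].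
  exact: continuous_functions_eval.
(* Pointwise convergence suffices for the inverse: d(g u, z) and d(z, g u) are evaluations at [z] of
   the two components of [u]. *)
move=> u; apply: (lms_cvg d lms ncb (g @ u) (g u)
  (fmap_filter _ (nbhs_filter u))) => z; [exact: c2|exact: c1].
Qed.

(** * The metric gamma and its topology *)

Section GammaMetric.
Context {R : realType} {X : topologicalType} (d : X -> X -> R)
  (lms : lorentzian_metric_space d) (ncb : no_chronological_boundary d)
  (p : nat -> X) (gen : generating_sequence d p).

Let cX := Xm_compact d lms ncb p.
Let cl x : continuous (d x) := lms_continuousl lms (x := x).
Let cr x : continuous (d ^~ x) := lms_continuousr lms (x := x).
Let gammal := compact_series (Xm d p) d.
Let gammar := compact_series (Xm d p) (fun x z => d z x).

Let gammaE x y : gamma_metric d p x y = gammal x y + gammar x y.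
Proof. by []. Qed.

Let gammal_ge0 x y : 0 <= gammal x y. Proof. exact: compact_series_ge0. Qed.
Let gammar_ge0 x y : 0 <= gammar x y. Proof. exact: compact_series_ge0. Qed.

(** Closeness for gamma forces pointwise closeness of both functions, because [z] lies in some X^m
    with positive index and each half of gamma is at most gamma. *)
Lemma gamma_metric_control x z e : 0 < e -> exists2 r, 0 < r &
  forall y, gamma_metric d p x y < r ->
    `|d x z - d y z| < e /\ `|d z x - d z y| < e.
Proof.
move=> e0; have [m m0 zm] := Xm_cover d p gen z.
have [r1 r10 h1] := compact_series_control _ _ cX cl m z x e m0 zm e0.
have [r2 r20 h2] := compact_series_control _ _ cX cr m z x e m0 zm e0.
exists (Num.min r1 r2); first by rewrite lt_min r10.
move=> y; rewrite gammaE lt_min => /andP[xy1 xy2]; split.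
  by apply: h1; apply: le_lt_trans xy1; rewrite lerDl.
by apply: h2; apply: le_lt_trans xy2; rewrite lerDr.
Qed.

Lemma gamma_metric_is_metric : is_metric (gamma_metric d p).
Proof.
split=> [x y|x y|x y|x y z].
- by rewrite gammaE addr_ge0.
- split=> [xy0|->]; last first.
    by rewrite gammaE /gammal /gammar !compact_seriesxx addr0.
  (* A vanishing gamma is below every radius [r], so both differences are below every positive
     [e]. *)
  have h z : `|d x z - d y z| <= 0 /\ `|d z x - d z y| <= 0.
    split; apply/ler_addgt0Pr => e /(gamma_metric_control x z)[r r0 /(_ y)];
      by rewrite add0r xy0 => /(_ r0)[/ltW ? /ltW ?].
  by apply: (lms_separates d lms) => z; apply/eqP; rewrite -subr_eq0 -normr_le0;
    have [] := h z.
- by rewrite !gammaE; congr (_ + _); exact: compact_seriesC.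
- by rewrite !gammaE addrACA lerD//; exact: compact_series_triangle.
Qed.

(** Joint continuity of [d] gives uniform closeness on each compact X^m, so gamma-balls are
    neighbourhoods of their centres. *)
Lemma gamma_metric_near x e : 0 < e -> \forall y \near x, gamma_metric d p x y < e.
Proof.
move=> e0; have e20 : 0 < e / 2 by rewrite divr_gt0.
near=> y; rewrite gammaE [ltRHS]splitr ltrD//; near: y.
  apply: compact_series_near => // m r.
  exact: curry_near_compact (lms_continuous lms) (cX m).
apply: compact_series_near => // m r.
exact: curry_near_compact (lms_continuous_swap d lms) (cX m).
Unshelve. all: by end_near. Qed.

Lemma gamma_metric_induces_topology : induces_topology (gamma_metric d p).
Proof.
move=> U; split=> [oU x Ux|hU]; last first.
  rewrite openE => x /hU[r r0 rU]; exact: filterS rU (gamma_metric_near x r r0).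
(* The filter generated by the gamma-balls around [x] converges pointwise, hence to [x]; every open
   set containing [x] therefore contains such a ball. *)
pose F := filter_from [set r : R | 0 < r] (fun r => [set y | gamma_metric d p x y < r]).
have FF : Filter F.
  apply: filter_from_filter; first by exists 1 => /=.
  move=> r s r0 s0; exists (Num.min r s); first by rewrite /= lt_min r0.
  by move=> y /=; rewrite lt_min => /andP[].
have : F --> x.
  apply: (lms_cvg d lms ncb) => z; apply/cvgrPdist_lt => e e0;
    have [r r0 h] := gamma_metric_control x z e e0;
    by exists r => // y /h[].
by move=> /(_ U (open_nbhs_nbhs (conj oU Ux))).
Qed.

End GammaMetric.

Theorem theorem7p2 (R : realType) (X : topologicalType) (d : X -> X -> R)
    (lms : lorentzian_metric_space d) (ncb : no_chronological_boundary d) :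
  homeomorphism_onto_image (iota_map lms) /\
  (countably_generated d ->
   forall p : nat -> X, generating_sequence d p ->
     is_metric (gamma_metric d p) /\ induces_topology (gamma_metric d p)).
Proof.
split=> [|_ p gen]; first exact: iota_map_homeomorphism.
split; first exact: gamma_metric_is_metric.
exact: gamma_metric_induces_topology.
Qed.
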